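(* Let $n,\Delta,f,\lambda$ be nonnegative integers with $\lambda f\Delta\cdot 2^{f\Delta}\le n$. Then there exists an edge-colored directed graph $G$ on $\Theta(n)$ vertices, in which every color class has at most $\Delta$ edges, with a source vertex $s$, such that every $f$-CFT single-source $\lambda$-bounded flow preserver of $G$ with source $s$ has $\Omega(\lambda 2^{f\Delta} n)$ edges.
   Context: An edge-colored graph assigns each edge exactly one color (uncolored edges may be regarded as having a unique color used nowhere else), with no restrictions; a color class is the set of edges of one color. For a set $F$ of colors, $G-F$ denotes $G$ with all edges whose color is in $F$ deleted. A subgraph $H\subseteq G$ is an $f$-CFT single-source $\lambda$-bounded flow preserver of $G$ with source $s$ if for every set $F$ of at most $f$ colors and every vertex $t$, letting $\alpha$ be the maximum number of edge-disjoint $s\rightsquigarrow t$ paths in $G-F$: if $\alpha\le\lambda$ then $H-F$ contains $\alpha$ edge-disjoint $s\rightsquigarrow t$ paths, and if $\alpha>\lambda$ then $H-F$ contains at least $\lambda$ edge-disjoint $s\rightsquigarrow t$ paths.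
   Formalization: Assumes n ≥ 1, and Δ ≥ 1 unless λ = 0 (a source needs a vertex; for Δ = 0 < λ the graph has no edges and the bound fails). When λ > n, which forces f = 0 or λ = 0, G may have parallel edges, as a simple graph on Θ(n) vertices can have too few edges; otherwise G is simple. *)

(* Defs.v *)
From HB Require Import structures.
From mathcomp Require Import all_boot all_order all_algebra.
Set Implicit Arguments.
Unset Strict Implicit.
Unset Printing Implicit Defensive.

(* Finite directed graphs in which every edge carries exactly one color.
   Edges are objects of their own, so parallel edges are possible; see
   [simple_digraph]. *)
Record colored_digraph := ColoredDigraph {
  vertex : finType;
  edge   : finType;
  color  : finType;
  src    : edge -> vertex;
  tgt    : edge -> vertex;
  col    : edge -> color
}.

Section Flow.
Variable G : colored_digraph.

Definition simple_digraph : Prop :=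
  (forall e : edge G, src e != tgt e) /\
  (forall e1 e2 : edge G, src e1 = src e2 -> tgt e1 = tgt e2 -> e1 = e2).

Definition color_class (c : color G) : {set edge G} := [set e | col e == c].

(* A subgraph is given by its edge set [A]; this is [A - F]. *)
Definition del_colors (A : {set edge G}) (F : {set color G}) : {set edge G} :=
  [set e in A | col e \notin F].

Fixpoint is_walk (A : {set edge G}) (u v : vertex G) (p : seq (edge G)) : bool :=
  if p is e :: p' then [&& e \in A, src e == u & is_walk A (tgt e) v p']
  else u == v.

(* A path is a walk without repeated vertices. *)
Definition is_path (A : {set edge G}) (u v : vertex G) (p : seq (edge G)) : bool :=
  is_walk A u v p && uniq (u :: [seq tgt e | e <- p]).

Definition edge_disjoint_paths (A : {set edge G}) (s t : vertex G) (k : nat) : Prop :=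
  exists P : 'I_k -> seq (edge G),
    (forall i, is_path A s t (P i)) /\
    (forall i j, i != j -> [disjoint P i & P j]).

(* For t = s the empty path may be repeated at will, so there is no maximum:
   [max_edge_disjoint_paths A s s k] holds for no k. *)
Definition max_edge_disjoint_paths
    (A : {set edge G}) (s t : vertex G) (k : nat) : Prop :=
  edge_disjoint_paths A s t k /\
  (forall m, edge_disjoint_paths A s t m -> m <= k).

(* The target t = s imposes no condition, since every H contains any number
   of empty paths. *)
Definition CFT_flow_preserver
    (f lambda : nat) (s : vertex G) (H : {set edge G}) : Prop :=
  forall (F : {set color G}) (t : vertex G) (alpha : nat),
    #|F| <= f ->
    max_edge_disjoint_paths (del_colors [set: edge G] F) s t alpha ->
    (alpha <= lambda -> edge_disjoint_paths (del_colors H F) s t alpha) /\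
    (lambda < alpha -> edge_disjoint_paths (del_colors H F) s t lambda).

End Flow.

(* Main.v *)
Require Import Defs.
From HB Require Import structures.
From mathcomp Require Import all_boot all_order all_algebra.
From mathcomp Require Import zify.
Import Order.TTheory GRing.Theory Num.Theory.

Set Implicit Arguments.
Unset Strict Implicit.
Unset Printing Implicit Defensive.

(** Take [lambda] copies of a complete binary tree of depth [k = f * Delta], each
    joined to the source by one edge and with all its [2 ^ k] leaves joined to all
    of [n] sinks. Subdividing each tree edge at level [j] into [2 ^ (k - j)] edges
    allows every leaf [l] to own one private edge on each of the [k] branches that
    leave the path to [l]; these [k] edges are grouped into [f] colors of [Delta]
    edges. Deleting the colors owned by [l] in one copy makes [l] the only leaf
    reachable in that copy, while the maximum flow to any sink [x] stays [lambda].
    The edge from [l] to [x] together with the source edges of the other copies is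
    then a saturated cut, so every preserver contains the edge from [l] to [x].
    When [lambda > n], necessarily [f * Delta = 0], and a star with [lambda] parallel
    edges to each sink works. *)

(** * Walks, ranks and saturated cuts *)

Lemma walk_all_mem (G : colored_digraph) (A : {set edge G}) u v p :
  is_walk A u v p -> {subset p <= A}.
Proof.
elim: p u => [|e p IHp] u //= /and3P[eA _ /IHp pA] e'.
by rewrite inE => /predU1P[->|/pA].
Qed.

Lemma walk_sub (G : colored_digraph) (A B : {set edge G}) u v p :
  A \subset B -> is_walk A u v p -> is_walk B u v p.
Proof.
move=> /subsetP sAB; elim: p u => [|e p IHp] u //= /and3P[/sAB-> ->].
exact: IHp.
Qed.

Lemma walk_rcons (G : colored_digraph) (A : {set edge G}) u p e :
  is_walk A u (src e) p -> e \in A -> is_walk A u (tgt e) (rcons p e).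
Proof.
move=> + eA; elim: p u => [|e' p IHp] u /=.
  by move=> /eqP->; rewrite eA !eqxx.
by move=> /and3P[-> -> /IHp].
Qed.

Lemma walk_invariant (G : colored_digraph) (A : {set edge G})
    (I : pred (vertex G)) u v p :
  (forall e, e \in A -> e \in p -> I (src e) -> I (tgt e)) ->
  is_walk A u v p -> I u -> I v.
Proof.
elim: p u => [|e p IHp] u /= stepI; first by move=> /eqP->.
move=> /and3P[eA /eqP <- walk_p] Iu.
apply: IHp walk_p _ => [e' e'A e'p|]; last by apply: stepI; rewrite ?mem_head.
by apply: stepI; rewrite // inE e'p orbT.
Qed.

(** A strictly increasing rank excludes repeated vertices, so only walks have to be constructed in
    the trees. *)
Lemma ranked_walk_is_path (G : colored_digraph) (A : {set edge G})
    (rank : vertex G -> nat) u v p :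
  (forall e : edge G, rank (src e) < rank (tgt e)) ->
  is_walk A u v p -> is_path A u v p.
Proof.
move=> rank_lt walk_p; rewrite /is_path walk_p /=.
suff: sorted (relpre rank ltn) (u :: [seq tgt e | e <- p]).
  apply: sorted_uniq => [x y z|x] /=; last exact: ltnn.
  exact: ltn_trans.
elim: p u walk_p => [|e p IHp] u //= /and3P[_ /eqP <- /IHp].
by rewrite rank_lt.
Qed.

(** Picking an edge of [C] on each path is injective by disjointness, hence onto [C] once [C] has at
    most [m] edges. *)
Lemma disjoint_transversal_card (G : colored_digraph) (C : {set edge G}) m
    (P : 'I_m -> seq (edge G)) :
  (forall i, has [in C] (P i)) -> (forall i j, i != j -> [disjoint P i & P j]) ->
  m <= #|C| /\
  (#|C| <= m -> forall c, c \in C -> exists i, c \in P i).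
Proof.
move=> PC Pdisj.
have /fin_all_exists[g gP] i : exists c, (c \in P i) && (c \in C).
  by have /hasP[c cP cC] := PC i; exists c; rewrite cP.
have g_inj : injective g.
  move=> i j gij; apply/eqP/negPn/negP => /Pdisj /disjointFr.
  have /andP[giP _] := gP i; have /andP[gjP _] := gP j.
  by move=> /(_ _ giP); rewrite gij gjP.
have card_g : #|[set g i | i : 'I_m]| = m by rewrite card_imset ?card_ord.
have gC : [set g i | i : 'I_m] \subset C.
  by apply/subsetP => c /imsetP[i _ ->]; case/andP: (gP i).
split=> [|leCm c]; first by rewrite -[leqLHS]card_g subset_leq_card.
have /eqP <- : [set g i | i : 'I_m] == C by rewrite eqEcard gC card_g.
by move=> /imsetP[i _ ->]; exists i; case/andP: (gP i).
Qed.

(** The cut bounds the flow by [lambda], so the maximum is exactly [lambda]; the [lambda] disjoint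
    paths kept in [H] cross the cut in distinct edges and thus exhaust [C]. *)
Lemma preserver_contains_saturated_cut (G : colored_digraph) f lambda s
    (H C : {set edge G}) (F : {set color G}) t :
  CFT_flow_preserver f lambda s H -> #|F| <= f -> #|C| <= lambda ->
  edge_disjoint_paths (del_colors [set: edge G] F) s t lambda ->
  (forall p, is_walk (del_colors [set: edge G] F) s t p -> has [in C] p) ->
  C \subset H.
Proof.
move=> presH leF leC flow cutC.
have [|+ _] := presH F t lambda leF.
  split=> // m [P [pathP disjP]]; apply: leq_trans leC.
  by apply: (disjoint_transversal_card _ disjP).1 => i; case/andP: (pathP i) => /cutC.
case=> // P [pathP disjP]; apply/subsetP => c cC.
have meetP i : has [in C] (P i).
  have /andP[walkP _] := pathP i; apply/cutC/(walk_sub _ walkP)/subsetP => e.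
  by rewrite !inE => /andP[_ ->].
have [i cPi] := (disjoint_transversal_card meetP disjP).2 leC c cC.
have /andP[/walk_all_mem/(_ _ cPi)] := pathP i.
by rewrite inE => /andP[].
Qed.

(** * The star with parallel edges *)

Definition star_multigraph (lambda n : nat) : colored_digraph :=
  @ColoredDigraph (option 'I_n) ('I_lambda * 'I_n)%type ('I_lambda * 'I_n)%type
    (fun=> None) (fun e => Some e.2) id.

(** With no color deleted, the [lambda] parallel edges to a sink already form a saturated cut. *)
Lemma star_multigraph_preserver f lambda n
    (H : {set edge (star_multigraph lambda n)}) :
  CFT_flow_preserver f lambda (None : vertex (star_multigraph lambda n)) H ->
  H = [set: edge (star_multigraph lambda n)].
Proof.
move=> presH; apply/setP => -[i x]; rewrite inE.
pose G := star_multigraph lambda n.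
pose C : {set edge G} := [set (j, x) | j : 'I_lambda].
suff /subsetP sCH : C \subset H by apply: sCH; apply/imsetP; exists i.
apply: (preserver_contains_saturated_cut (F := set0) (t := Some x : vertex G) presH).
- by rewrite cards0.
- by apply: leq_trans (leq_imset_card _ _) _; rewrite card_ord.
- exists (fun j => [:: (j, x)]); split=> [j|j j' neqj].
    by rewrite /is_path /= !inE /= !eqxx.
  by rewrite disjoint_has /= inE xpair_eqE eqxx andbT orbF.
case=> [|[j y] [|[j' y'] p]] //=; last by rewrite !andbF.
rewrite !inE => /andP[_ /eqP[->]]; rewrite orbF.
by apply/imsetP; exists j.
Qed.

(** * Flipping binary digits *)

(** On node addresses this exchanges the two children of one parent. *)
Definition flip_odd (a : nat) : nat := if odd a then a.-1 else a.+1.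

Lemma flip_oddK : involutive flip_odd.
Proof.
case=> [|a] //; rewrite /flip_odd /=.
by case: (boolP (odd a)) => [a_odd|/negbTE a_even] /=; rewrite ?a_odd ?a_even.
Qed.

Lemma flip_odd_half a : (flip_odd a)./2 = a./2.
Proof.
rewrite /flip_odd; case: ifPn => [|/negbTE a_even] /=.
  by case: a => //= a /negbTE a_even; rewrite uphalf_half a_even.
by rewrite uphalf_half a_even.
Qed.

(* Flips the binary digit of [q] of weight [m], for [m] a power of 2. *)
Definition flip (m q : nat) : nat := flip_odd (q %/ m) * m + q %% m.

Lemma flip_div m q : 0 < m -> flip m q %/ m = flip_odd (q %/ m).
Proof. by move=> m0; rewrite /flip divnMDl // (divn_small (ltn_pmod _ m0)) addn0. Qed.

Lemma flip_mod m q : flip m q %% m = q %% m.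
Proof. by rewrite /flip modnMDl modn_mod. Qed.

Lemma flipK m : 0 < m -> involutive (flip m).
Proof.
by move=> m0 q; rewrite {1}/flip flip_mod flip_div // flip_oddK -divn_eq.
Qed.

Lemma flip_div_neq m q : 0 < m -> flip m q %/ m != q %/ m.
Proof.
move=> m0; rewrite flip_div // /flip_odd; case: ifP => [|_]; last by rewrite gtn_eqF.
by case: (q %/ m) => //= a _; rewrite ltn_eqF.
Qed.

Lemma flip_div_double m q : 0 < m -> flip m q %/ (m * 2) = q %/ (m * 2).
Proof. by move=> m0; rewrite !divnMA flip_div // !divn2 flip_odd_half. Qed.

Lemma flip_ltn_pow k j q : 0 < j <= k -> q < 2 ^ k -> flip (2 ^ (k - j)) q < 2 ^ k.
Proof.
case: j => // j /= lejk; have -> : 2 ^ k = 2 ^ j * (2 ^ (k - j.+1) * 2).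
  by rewrite -expnSr -expnD; congr (2 ^ _); lia.
by rewrite -!ltn_divLR ?muln_gt0 ?expn_gt0 // flip_div_double ?expn_gt0.
Qed.

Lemma flip_odd_cases a b : a %/ 2 = b %/ 2 -> a = b \/ a = flip_odd b.
Proof.
rewrite !divn2 => ab2; rewrite /flip_odd.
rewrite -[a in a = _ \/ _]odd_double_half -[a in _ \/ a = _]odd_double_half ab2.
rewrite -[b in b.-1]odd_double_half -[b in b.+1]odd_double_half.
rewrite -[b in _ = b \/ _]odd_double_half.
by case: (odd a); case: (odd b) => /=; rewrite ?add0n ?add1n; auto.
Qed.

(** One step along a subdivided tree edge keeps the node address and advances the segment number. *)
Lemma divmodS m q : ~~ (m %| q.+1) -> q %/ m = q.+1 %/ m /\ q.+1 %% m = (q %% m).+1.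
Proof.
case: m => [|m]; first by rewrite !divn0 !modn0.
by rewrite /dvdn modnS divnS //; case: ifP; rewrite // add0n.
Qed.

Lemma eq_divmod m a b : a %/ m = b %/ m -> a %% m = b %% m -> a = b.
Proof. by move=> eq_div eq_mod; rewrite (divn_eq a m) eq_div eq_mod -divn_eq. Qed.

(** * Subdivided binary trees and their coloring *)

(* In copy [i], with [m = 2 ^ (k - j)], the vertex [(i, j, q)] is the end of the
   segment numbered [q %% m] of the subdivided tree edge entering the node of level
   [j] whose address is the binary word [q %/ m]. The root edge is level [0], also
   subdivided, so that every vertex is the target of exactly one edge and tree edges
   can be named by their targets. *)
Definition tree_vertex (lambda k : nat) : finType := ('I_lambda * 'I_k.+1 * 'I_(2 ^ k))%type.

(** Segment 0 of a non-root tree edge starts at the end of the last segment, numbered [2m - 1], one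
    level up; any other segment starts where its predecessor ends. [None] stands for the source. *)
Definition parent lambda k (v : tree_vertex lambda k) : option (tree_vertex lambda k) :=
  let: (i, j, q) := v in
  let m := 2 ^ (k - j) in
  if m %| q then
    if j == ord0 then None
    else Some (i, inord j.-1, insubd q (q %/ (m * 2) * (m * 2) + (m * 2).-1))
  else Some (i, j, insubd q q.-1).

Arguments parent : simpl never.

Variant parent_spec lambda k (i : 'I_lambda) (j : 'I_k.+1) (q : 'I_(2 ^ k)) :
    option (tree_vertex lambda k) -> Type :=
  | ParentRoot of j = 0 :> nat & q = 0 :> nat : parent_spec i j q None
  | ParentBranch (j' : 'I_k.+1) (q' : 'I_(2 ^ k)) of
      j = j'.+1 :> nat & 2 ^ (k - j) %| q &
      q' %/ (2 ^ (k - j) * 2) = q %/ (2 ^ (k - j) * 2) &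
      q' %% (2 ^ (k - j) * 2) = (2 ^ (k - j) * 2).-1
      : parent_spec i j q (Some (i, j', q'))
  | ParentSegment (q' : 'I_(2 ^ k)) of
      ~~ (2 ^ (k - j) %| q) & q = q'.+1 :> nat
      : parent_spec i j q (Some (i, j, q')).

Lemma pow_gt0 k j : 0 < 2 ^ (k - j). Proof. by rewrite expn_gt0. Qed.

Lemma double_pow_subS k j : j < k -> 2 ^ (k - j.+1) * 2 = 2 ^ (k - j).
Proof. by move=> ltjk; rewrite -expnSr subnSK. Qed.

Lemma insubd_ordK n (u : 'I_n) x : x < n -> insubd u x = x :> nat.
Proof. by move=> ltxn; rewrite val_insubd ltxn. Qed.

Lemma parentP lambda k (i : 'I_lambda) (j : 'I_k.+1) (q : 'I_(2 ^ k)) :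
  parent_spec i j q (parent (i, j, q)).
Proof.
rewrite /parent; set m := 2 ^ (k - j); have m0 : 0 < m := pow_gt0 k j.
case: ifPn => [mq|mNq]; last first.
  have q0 : 0 < q by rewrite lt0n; apply: contraNneq mNq => ->; rewrite dvdn0.
  have lt_pred : q.-1 < 2 ^ k by apply: leq_ltn_trans (ltn_ord q); lia.
  by apply: ParentSegment => //; rewrite insubd_ordK // prednK.
case: (altP (j =P ord0)) => [j0|jN0].
  constructor; first by rewrite j0.
  by move: mq; rewrite /m j0 subn0 => /dvdnP[[|a] // qE]; have := ltn_ord q; rewrite qE; lia.
have j_gt0 : 0 < j by rewrite lt0n.
have lejk : j <= k by rewrite -ltnS.
set q' := _ + (m * 2).-1.
have lt_pred : (m * 2).-1 < m * 2 by lia.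
have q'_div : q' %/ (m * 2) = q %/ (m * 2).
  by rewrite divnMDl ?muln_gt0 ?m0 // (divn_small lt_pred) addn0.
have lt_q' : q' < 2 ^ k.
  have -> : 2 ^ k = 2 ^ j.-1 * (m * 2).
    by rewrite /m -expnSr -expnD; congr (2 ^ _); lia.
  rewrite -ltn_divLR ?muln_gt0 ?m0 // q'_div ltn_divLR ?muln_gt0 ?m0 //.
  by rewrite /m -expnSr -expnD; apply: leq_trans (ltn_ord q) _; rewrite leq_exp2l //; lia.
apply: ParentBranch => //.
- by rewrite inordK ?prednK // ltnW // ltnS.
- by rewrite insubd_ordK.
by rewrite insubd_ordK // modnMDl modn_small.
Qed.

(* The edge into [(i, j, q)] with [j > 0] is owned by the leaf that differs from [q]
   in digit [j] only. All edges outside the branches get a color of their own. *)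
Definition tree_graph (f Delta lambda n : nat) : colored_digraph :=
  let k := f * Delta in
  let E : finType := (tree_vertex lambda k + 'I_lambda * 'I_(2 ^ k) * 'I_n)%type in
  @ColoredDigraph
    (option (tree_vertex lambda k + 'I_n)%type) E
    ('I_lambda * 'I_(2 ^ k) * 'I_k.+1 + E)%type
    (fun e => match e with
       | inl v => omap inl (parent v)
       | inr (i, q, _) => Some (inl (i, ord_max, q))
     end)
    (fun e => match e with
       | inl v => Some (inl v)
       | inr (_, _, x) => Some (inr x)
     end)
    (fun e => match e with
       | inl (i, j, q) =>
           if j == ord0 then inr e
           else inl (i, insubd q (flip (2 ^ (k - j)) q), inord (j.-1 %/ Delta))
       | inr _ => inr e
     end).

(** Lexicographic rank: level first, then segment number, which stays below [2 ^ k]; sinks lie above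
    all levels. *)
Definition tree_rank f Delta lambda n (v : vertex (tree_graph f Delta lambda n)) : nat :=
  let k := f * Delta in
  match v with
  | None => 0
  | Some (inl (_, j, q)) => (j * 2 ^ k + q %% 2 ^ (k - j)).+1
  | Some (inr _) => (k.+1 * 2 ^ k).+1
  end.

Lemma tree_rank_lt f Delta lambda n (e : edge (tree_graph f Delta lambda n)) :
  tree_rank (src e) < tree_rank (tgt e).
Proof.
have mod_lt (j q : nat) : q %% 2 ^ (f * Delta - j) < 2 ^ (f * Delta).
  by apply: leq_trans (ltn_pmod _ (pow_gt0 _ _)) _; rewrite leq_exp2l // leq_subr.
case: e => [[[i j] q]|[[i q] x]] /=; last by rewrite ltnS mulSnr ltn_add2l mod_lt.
case: (parentP i j q) => [_ _|j' q' jE _ _ _|q' mNq qE] /=.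
- by [].
- by rewrite jE ltnS mulSnr -addnA ltn_add2l ltn_addr.
by rewrite qE in mNq *; have [_ ->] := divmodS mNq; rewrite ltnS addnS.
Qed.

Lemma tree_graph_simple f Delta lambda n : simple_digraph (tree_graph f Delta lambda n).
Proof.
split=> [e|]; first by apply/eqP => eq_e; have := tree_rank_lt e; rewrite eq_e ltnn.
case=> [v|[[i q] x]] [v'|[[i' q'] x']] //=; first by move=> _ [->].
by move=> [-> ->] [->].
Qed.

Lemma tree_graph_card f Delta lambda n :
  #|vertex (tree_graph f Delta lambda n)| =
    (lambda * (f * Delta).+1 * 2 ^ (f * Delta) + n).+1.
Proof. by rewrite card_option card_sum !card_prod !card_ord. Qed.

(** * Reachability once the colors of a leaf are deleted *)

(* The vertices reachable from the root of their copy once the branches leaving the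
   path to leaf [l] are cut: either on that path, or on a sibling branch, before its cut. *)
Definition near_leaf k (l : nat) (j : 'I_k.+1) (q : nat) : bool :=
  let m := 2 ^ (k - j) in
  (q %/ m == l %/ m) || ((q %/ m == flip_odd (l %/ m)) && (q %% m < l %% m)).

Lemma eq_flip m l q : 0 < m ->
  q %/ m = flip_odd (l %/ m) -> q %% m = l %% m -> flip m q = l.
Proof.
move=> m0 eq_div eq_mod; apply: (@eq_divmod m); rewrite ?flip_mod //.
by rewrite flip_div // eq_div flip_oddK.
Qed.

(** The region can be left only at segment [l %% m] of a sibling branch, and the edge entering there
    is the cut one. *)
Lemma near_leaf_parent lambda k (l : 'I_(2 ^ k)) (i i' : 'I_lambda)
    (j j' : 'I_k.+1) (q q' : 'I_(2 ^ k)) :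
  parent (i, j, q) = Some (i', j', q') ->
  (j != ord0 -> flip (2 ^ (k - j)) q != l) ->
  near_leaf l j' q' -> near_leaf l j q.
Proof.
rewrite /near_leaf; have m0 := pow_gt0 k j.
have at_root : j = ord0 -> q %/ 2 ^ (k - j) == l %/ 2 ^ (k - j).
  by move=> ->; rewrite subn0 !divn_small.
case: (altP (j =P ord0)) => [/at_root-> //|jN0].
case: parentP => // [j1 q1 jE mq eq_div eq_mod|q1 mNq qE] [_ <- <-] /(_ isT) uncut.
  have ltj1k : j1 < k by rewrite -ltnS -jE ltn_ord.
  have mE : 2 ^ (k - j1) = 2 ^ (k - j) * 2 by rewrite jE double_pow_subS.
  rewrite mE eq_div eq_mod; move: (2 ^ (k - j)) m0 mq uncut => m m0 mq uncut.
  (* The parent is a last segment, numbered [2m - 1], which is never below [l %% (2m)]; so it lies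
     on the path to [l]. *)
  case/orP=> [|/andP[_]]; last first.
    by rewrite ltnNge -ltnS prednK ?ltn_pmod ?muln_gt0 ?m0.
  rewrite !divnMA => /eqP/flip_odd_cases[->|eq_flp]; first by rewrite eqxx.
  apply/orP; right; rewrite eq_flp eqxx /= (eqP mq) lt0n.
  by apply: contraNneq uncut => l0; apply/eqP/eq_flip; rewrite // l0 (eqP mq).
move: (2 ^ (k - j)) m0 mNq uncut => m m0; rewrite qE => mNq uncut.
have [eq_div eq_mod] := divmodS mNq; rewrite -eq_div.
case/orP=> [->//|/andP[/eqP flp lt_mod]]; rewrite flp eqxx /= orbC eq_mod ltn_neqAle lt_mod.
rewrite andbT; apply/orP; left; apply: contraNneq uncut => eq_l.
by apply/eqP/eq_flip; rewrite // -?eq_div // eq_mod.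
Qed.

(** * Colors owned by a leaf, surviving flow and its cut *)

Definition sibling_colors f Delta lambda n (i : 'I_lambda) (l : 'I_(2 ^ (f * Delta))) :
    {set color (tree_graph f Delta lambda n)} :=
  [set inl (i, l, inord b) | b : 'I_f].

Lemma card_sibling_colors f Delta lambda n i l :
  #|@sibling_colors f Delta lambda n i l| <= f.
Proof. by apply: leq_trans (leq_imset_card _ _) _; rewrite card_ord. Qed.

Lemma sibling_colorsE f Delta lambda n i0 l (e : edge (tree_graph f Delta lambda n)) :
  (Defs.col e \in sibling_colors n i0 l) =
    if e is inl (i, j, q) then
      [&& j != ord0, i == i0 & flip (2 ^ (f * Delta - j)) q == l]
    else false.
Proof.
case: e => [[[i j] q]|[[i q] x]] /=; last first.
  by apply/negbTE/negP => /imsetP[].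
case: eqP => [j0|/eqP jN0] /=; first by apply/negbTE/negP => /imsetP[].
have j_gt0 : 0 < j by rewrite lt0n.
have lejk : j <= f * Delta by rewrite -ltnS.
have /andP[_ Delta_gt0] : (0 < f) && (0 < Delta) by rewrite -muln_gt0 (leq_trans j_gt0).
have flip_lt := flip_ltn_pow (introT andP (conj j_gt0 lejk)) (ltn_ord q).
apply/imsetP/andP => [[b _ [-> <- _]]|[/eqP-> /eqP flipE]].
  by rewrite eqxx insubd_ordK.
(* Levels 1 to [f * Delta] split into [f] blocks of [Delta], one color per block. *)
have ltb : j.-1 %/ Delta < f by rewrite ltn_divLR // prednK.
exists (Ordinal ltb) => //=; congr (inl (_, _, _)).
by apply: val_inj; rewrite /= insubd_ordK.
Qed.

(** Parents of vertices on the path to [l] stay on it, and every cut edge enters a vertex off that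
    path. Staying in copy [i] later yields disjointness. *)
Lemma walk_to_trunk f Delta lambda n (i0 i : 'I_lambda) (l : 'I_(2 ^ (f * Delta)))
    (j : 'I_(f * Delta).+1) (q : 'I_(2 ^ (f * Delta))) :
  q %/ 2 ^ (f * Delta - j) = l %/ 2 ^ (f * Delta - j) ->
  exists2 p : seq (edge (tree_graph f Delta lambda n)),
    is_walk (del_colors setT (sibling_colors n i0 l)) None (Some (inl (i, j, q))) p
    & forall e, e \in p -> exists v, e = inl (i, v.1, v.2).
Proof.
(* Induction on a strict bound for the rank, which drops from a vertex to its parent. *)
move: {2}_.+1 (ltnSn (@tree_rank f Delta lambda n (Some (inl (i, j, q))))) => r.
elim: r j q => // r IHr j q; rewrite ltnS => le_rank trunk.
pose e : edge (tree_graph f Delta lambda n) := inl (i, j, q).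
have rank_lt := leq_trans (tree_rank_lt e) le_rank.
have uncut : e \in del_colors setT (sibling_colors n i0 l).
  rewrite !inE sibling_colorsE /= !negb_and.
  apply/orP; right; apply/orP; right; apply/eqP => flipE.
  by have := flip_div_neq q (pow_gt0 (f * Delta) j); rewrite flipE trunk eqxx.
have extend p : is_walk (del_colors setT (sibling_colors n i0 l)) None (src e) p ->
    (forall e', e' \in p -> exists v, e' = inl (i, v.1, v.2)) ->
  exists2 p' : seq (edge (tree_graph f Delta lambda n)),
    is_walk (del_colors setT (sibling_colors n i0 l)) None (Some (inl (i, j, q))) p'
    & forall e', e' \in p' -> exists v, e' = inl (i, v.1, v.2).
  move=> walk_p copy_p; exists (rcons p e); first exact: walk_rcons.
  by move=> e'; rewrite mem_rcons inE => /predU1P[->|/copy_p//]; exists (j, q).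
move: extend rank_lt; rewrite /=.
case: (parentP i j q) => /= [_ _|j' q' jE mq eq_div _|q' mNq qE] extend rank_lt.
- by apply: (extend [::]).
- have ltj'k : j' < f * Delta by rewrite -ltnS -jE ltn_ord.
  have [|p] := IHr j' q' rank_lt; last exact: extend.
  by rewrite -double_pow_subS // -jE eq_div !divnMA trunk.
have [|p] := IHr j q' rank_lt; last exact: extend.
by rewrite -trunk qE; rewrite qE in mNq; have [] := divmodS mNq.
Qed.

Lemma tree_graph_flow f Delta lambda n (i0 : 'I_lambda) (l : 'I_(2 ^ (f * Delta)))
    (x : 'I_n) :
  edge_disjoint_paths (G := tree_graph f Delta lambda n)
    (del_colors setT (sibling_colors n i0 l)) None (Some (inr x)) lambda.
Proof.
pose A := del_colors [set: edge (tree_graph f Delta lambda n)] (sibling_colors n i0 l).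
pose copy (e : edge (tree_graph f Delta lambda n)) : 'I_lambda :=
  match e with inl (i, _, _) => i | inr (i, _, _) => i end.
have /fin_all_exists[P walkP] (i : 'I_lambda) :
    exists p, is_walk A None (Some (inr x)) p /\ {in p, forall e, copy e = i}.
  have [p walk_p copy_p] := walk_to_trunk n i0 i (erefl (l %/ 2 ^ (f * Delta - @ord_max (f * Delta)))).
  pose e : edge (tree_graph f Delta lambda n) := inr (i, l, x).
  exists (rcons p e); split.
    by apply: (walk_rcons (e := e) walk_p); rewrite !inE sibling_colorsE.
  by move=> e'; rewrite mem_rcons inE => /predU1P[->//|/copy_p[v ->]].
exists P; split=> [i|i j]; first exact: ranked_walk_is_path (@tree_rank_lt _ _ _ _) (walkP i).1.
apply: contraR => /pred0Pn[e /andP[/= ePi ePj]].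
by rewrite -((walkP i).2 e ePi) ((walkP j).2 e ePj).
Qed.

Lemma preserver_contains_leaf_edge f Delta lambda n
    (H : {set edge (tree_graph f Delta lambda n)}) i l x :
  CFT_flow_preserver f lambda (None : vertex (tree_graph f Delta lambda n)) H ->
  inr (i, l, x) \in H.
Proof.
move=> presH; pose G := tree_graph f Delta lambda n.
pose root_edge i' : edge G := inl (i', ord0, insubd l 0).
pose C : {set edge G} :=
  [set (if i' == i then inr (i, l, x) : edge G else root_edge i') | i' : 'I_lambda].
suff /subsetP sCH : C \subset H by apply: sCH; apply/imsetP; exists i; rewrite ?eqxx.
apply: (preserver_contains_saturated_cut presH (card_sibling_colors _ i l)).
- by apply: leq_trans (leq_imset_card _ _) _; rewrite card_ord.
- exact: tree_graph_flow i l x.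
move=> p walk_p; apply: contraT => /hasPn uncut_p.
(* This invariant holds at the source, fails at [x], and survives every remaining edge outside [C]:
   the other copies are shut off at their root edges. *)
pose reached (v : vertex G) : bool :=
  match v with
  | None => true
  | Some (inl (i', j, q)) => (i' == i) && near_leaf l j q
  | Some (inr y) => y != x
  end.
suff: reached (Some (inr x)) by rewrite /= eqxx.
apply: (walk_invariant _ walk_p) => // e; rewrite !inE sibling_colorsE /= => + /uncut_p.
case: e => [[[i' j] q]|[[i' q] y]] /=.
  case def_v: (parent (i', j, q)) => [[[i1 j1] q1]|] /=.
    have -> : i1 = i' by move: def_v; case: parentP => // [? ?|?] ? ? => [??|] [].
    move=> uncut _ /andP[/eqP eq_i near_v]; rewrite eq_i eqxx /=.
    apply: near_leaf_parent def_v _ near_v => jN0.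
    by move: uncut; rewrite jN0 eq_i eqxx.
  move: def_v; case: parentP => // j0 q0 _ _ /negP notC _.
  have eq_j : j = ord0 by apply: val_inj.
  rewrite /near_leaf eq_j subn0 !divn_small // eqxx andbT.
  apply: contraT => neq_i; case: notC; apply/imsetP; exists i' => //.
  rewrite (negbTE neq_i) eq_j /root_edge; congr (inl (_, _, _)).
  by apply: val_inj; rewrite /= insubd_ordK ?expn_gt0.
(* At level [k] the modulus is 1, so [l] is the only reachable leaf, and its edge to [x] lies in
   [C]. *)
move=> _ notC /andP[/eqP eq_i]; rewrite /near_leaf subnn !divn1 !modn1 andbF orbF.
move=> /eqP/val_inj eq_q; apply: contraNneq notC => ->.
by apply/imsetP; exists i; rewrite ?eqxx // eq_i eq_q.
Qed.

(** * Edge count and color class sizes *)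

Lemma tree_graph_preserver_card f Delta lambda n
    (H : {set edge (tree_graph f Delta lambda n)}) :
  CFT_flow_preserver f lambda (None : vertex (tree_graph f Delta lambda n)) H ->
  lambda * 2 ^ (f * Delta) * n <= #|H|.
Proof.
move=> presH; pose leaf_edge u : edge (tree_graph f Delta lambda n) := inr u.
have inr_inj : injective leaf_edge by move=> ? ? [].
have <- : #|[set leaf_edge u | u in setT]| = lambda * 2 ^ (f * Delta) * n.
  by rewrite card_imset // cardsT !card_prod !card_ord.
apply/subset_leq_card/subsetP => _ /imsetP[[[i l] x] _ ->].
exact: preserver_contains_leaf_edge.
Qed.

Lemma tree_graph_color_class f Delta lambda n (c : color (tree_graph f Delta lambda n)) :
  0 < Delta \/ lambda = 0 -> #|color_class c| <= Delta.
Proof.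
case=> [Delta_gt0|lambda0]; last first.
  apply: leq_trans (max_card _) _; rewrite card_sum !card_prod !card_ord lambda0.
  by rewrite !mul0n.
case: c => [[[i l] b]|e0]; last first.
  have sub1 : color_class (inr e0 : color (tree_graph f Delta lambda n)) \subset [set e0].
    apply/subsetP => e; rewrite !inE; case: e => [[[? ?] ?]|[[? ?] ?]] /= => [|/eqP[<-] //].
    by case: ifP => // _ /eqP[<-].
  by apply: leq_trans (subset_leq_card sub1) _; rewrite cards1.
(* An edge of color [(i, l, b)] is determined by its level, as flipping is an involution, and block
   [b] has [Delta] levels. *)
pose k := f * Delta; pose level (r : 'I_Delta) : 'I_k.+1 := inord (b * Delta + r).+1.
pose edge_of (r : 'I_Delta) : edge (tree_graph f Delta lambda n) :=
  inl (i, level r, insubd l (flip (2 ^ (k - level r)) l)).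
suff sub_im : color_class (inl (i, l, b) : color (tree_graph f Delta lambda n))
    \subset [set edge_of r | r : 'I_Delta].
  apply: leq_trans (subset_leq_card sub_im) _.
  by apply: leq_trans (leq_imset_card _ _) _; rewrite card_ord.
apply/subsetP => -[[[i' j] q]|[[i' q] x]]; rewrite [in X in X -> _]inE //=.
case: ifPn => [//|jN0] /eqP[eq_i eq_l eq_b].
have j_gt0 : 0 < j by rewrite lt0n.
have lejk : j <= k by rewrite -ltnS.
have flip_lt := flip_ltn_pow (introT andP (conj j_gt0 lejk)) (ltn_ord q).
have flip_q : flip (2 ^ (k - j)) q = l by rewrite -eq_l insubd_ordK.
have level_j : level (Ordinal (ltn_pmod j.-1 Delta_gt0)) = j.
  have lt_block : j.-1 %/ Delta < k.+1.
    by rewrite ltnS; apply: leq_trans (leq_div _ _) (leq_trans (leq_pred _) lejk).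
  by apply: val_inj; rewrite /level /= -eq_b (inordK lt_block) -divn_eq prednK // inordK.
apply/imsetP; exists (Ordinal (ltn_pmod j.-1 Delta_gt0)) => //.
rewrite /edge_of level_j eq_i; congr (inl (_, _, _)); apply: val_inj => /=.
by rewrite insubd_ordK -flip_q flipK ?expn_gt0.
Qed.

(** * Constants and the split at [lambda = n] *)

Theorem theoremA3 :
  exists c1 c2 c3 : rat,
    [/\ (0 < c1)%R, (0 < c2)%R & (0 < c3)%R] /\
    forall n Delta f lambda : nat,
      0 < n ->
      0 < Delta \/ lambda = 0 ->
      lambda * f * Delta * 2 ^ (f * Delta) <= n ->
      exists (G : colored_digraph) (s : vertex G),
        [/\ (lambda <= n -> simple_digraph G),
            (c1 * n%:R <= #|vertex G|%:R <= c2 * n%:R)%R,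
            (forall c : color G, #|color_class c| <= Delta)
          & (forall H : {set edge G}, CFT_flow_preserver f lambda s H ->
               (c3 * (lambda * 2 ^ (f * Delta) * n)%:R <= #|H|%:R)%R)].
Proof.
(* The 4 covers the tree graph's [lambda * k * 2 ^ k + lambda * 2 ^ k + n + 1] vertices, each
   summand being at most [n]. *)
exists 1%R, 4%:R%R, 1%R; split=> // n Delta f lambda n_gt0 Delta_lambda size_le.
set k := f * Delta in size_le *.
have {}size_le : lambda * k * 2 ^ k <= n by rewrite mulnA.
have [lambda_le|lambda_gt] := leqP lambda n; last first.
  (* A positive [k] would give [lambda <= lambda * k * 2 ^ k <= n]. *)
  have k0 : k = 0.
    apply/eqP; rewrite -leqn0 leqNgt; apply/negP => k_gt0.
    suff : lambda <= n by rewrite leqNgt lambda_gt.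
    by apply: leq_trans size_le; rewrite -mulnA leq_pmulr // muln_gt0 k_gt0 expn_gt0.
  exists (star_multigraph lambda n), None; split.
  - by [].
  - by rewrite card_option card_ord !mul1r -natrM !ler_nat leqnSn; lia.
  - move=> c; case: Delta_lambda => [|lambda0]; last by rewrite lambda0 in lambda_gt.
    by apply: leq_trans; rewrite -(cards1 c); apply/subset_leq_card/subsetP => e; rewrite !inE.
  move=> H /star_multigraph_preserver ->.
  by rewrite mul1r ler_nat cardsT card_prod !card_ord k0 muln1.
exists (tree_graph f Delta lambda n), None; split.
- by move=> _; apply: tree_graph_simple.
- rewrite tree_graph_card !mul1r -natrM !ler_nat -/k.
  apply/andP; split; first by rewrite ltnW // ltnS leq_addl.
  have : lambda * 2 ^ k <= n.
    have [->|k_gt0] := posnP k; first by rewrite muln1.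
    by apply: leq_trans size_le; rewrite leq_mul2r leq_pmulr ?orbT.
  by nia.
- by move=> c; apply: tree_graph_color_class.
by move=> H /tree_graph_preserver_card; rewrite mul1r ler_nat.
Qed.
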